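(* For each integer $m$ with $0\le m\le 4$, $$\Lambda_m^+ = Q^{m}\,\Lambda_0^+,\qquad \Lambda_m^- = Q^{-m}\,\Lambda_0^-,$$ where $\Lambda_m^\pm=[\lambda_m^\pm;\pm(2m+1)\mu]$ are the explicit algebraic Painlevé VI solutions given in the context, and $Q=B R_5$, $Q^{-1}=R_5B$ are the Okamoto transformations given in the context.
   Context: Parameters. Let $\mu=(\tfrac12,\tfrac12,\tfrac12,\tfrac12)\in\mathbb C^4$, let $\varepsilon_1,\dots,\varepsilon_4$ be the standard basis of $\mathbb C^4$, and let $\cdot$ be the $\mathbb C$-bilinear dot product on $\mathbb C^4$. Functions. Algebraic functions of $t$ are given implicitly by a rational parameter $w$: everything is an element of $\mathbb C(w)$, with $$t=t(w)=\frac{(w+1)(w-3)^3}{(w-1)(w+3)^3},$$ and the derivative with respect to $t$ of $\lambda\in\mathbb C(w)$ is $\lambda'=\frac{d\lambda/dw}{dt/dw}$. A pair $\Lambda=[\lambda;\theta]$ consists of such a function $\lambda$ and a vector $\theta\in\mathbb C^4$; two pairs are equal if both entries agree. (In the source, $[\lambda;\theta]$ ''solves $P_{VI}$'' if $\lambda(t)$ solves $\lambda''=\frac12\big(\frac1\lambda+\frac1{\lambda-1}+\frac1{\lambda-t}\big)(\lambda')^2-\big(\frac1t+\frac1{t-1}+\frac1{\lambda-t}\big)\lambda'+\frac{\lambda(\lambda-1)(\lambda-t)}{2t^2(t-1)^2}\big((\theta_4-1)^2-\theta_1^2\frac{t}{\lambda^2}+\theta_3^2\frac{t-1}{(\lambda-1)^2}+(1-\theta_2^2)\frac{t(t-1)}{(\lambda-t)^2}\big)$.)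 Okamoto transformations. For $\Lambda=[\lambda;\theta]$: $R_j\Lambda=[\lambda;\theta-2(\varepsilon_j\cdot\theta)\varepsilon_j]$ for $j=1,2,3$; $R_4\Lambda=[\lambda;\theta-2(\varepsilon_4\cdot\theta-1)\varepsilon_4]$; and $$R_5\Lambda=\left[\lambda+\frac{2(\mu\cdot\theta)}{\frac{(t-1)\lambda'-\varepsilon_1\cdot\theta}{\lambda}+\frac{\lambda'-1-\varepsilon_2\cdot\theta}{\lambda-t}-\frac{t\lambda'+\varepsilon_3\cdot\theta}{\lambda-1}};\ \theta-2(\mu\cdot\theta)\mu\right]$$ (defined when the denominators are not identically zero). Products are compositions, the rightmost factor acting first. Set $B=(R_1R_2R_3R_5)\,R_4\,(R_5R_3R_2R_1)$, $Q=B R_5$, $Q^{-1}=R_5B$; $Q^{m}$ and $Q^{-m}$ denote $m$-fold iterates of $Q$ and $Q^{-1}$ respectively. Explicit solutions. $\Lambda_m^\pm=[\lambda_m^\pm;\pm(2m+1)\mu]$ with $$\lambda_m^\pm(w)=\frac{(w-3)^2}{(w-1)(w+3)}\cdot\frac{(w^2-1)f_m^\pm(w)+8g_m^\pm(w)}{(w^2+3)f_m^\pm(w)-24g_m^\pm(w)},$$ where, writing $s=w^2$: $m=0$: $f_0^+=1,\ g_0^+=0$; $f_0^-=0,\ g_0^-=1$. $m=1$: $f_1^+=1,\ g_1^+=0$; $f_1^-=4,\ g_1^-=3+s$. $m=2$: $f_2^+=12(3+s)^2$, $g_2^+=(s-1)^2$; $f_2^-=16(7+s)(4+3s+s^2)$,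 $g_2^-=(3+s)(77+89s+23s^2+3s^3)$. $m=3$: $f_3^+=8(3381+7536s+6291s^2+2576s^3+611s^4+80s^5+5s^6)$, $g_3^+=(s-1)^2(3+s)(147+111s+57s^2+5s^3)$; $f_3^-=12(3+s)^2(3528+7272s+6453s^2+2460s^3+678s^4+84s^5+5s^6)$, $g_3^-=164052+590328s+831465s^2+631260s^3+294435s^4+88938s^5+18207s^6+2520s^7+225s^8+10s^9$. $m=4$: $f_4^+=4(14619528+69918552s+140631309s^2+159541866s^3+116463663s^4+58384152s^5+20911122s^6+5489100s^7+1072278s^8+154176s^9+15729s^{10}+1050s^{11}+35s^{12})$, $g_4^+=3(s-1)^2(3+s)(141372+402732s+558819s^2+432297s^3+209331s^4+71361s^5+16497s^6+2403s^7+189s^8+7s^9)$; $f_4^-=8(326559519+1822652766s+4648210677s^2+6998194368s^3+7025103459s^4+5035679226s^5+2678780673s^6+1084740444s^7+341288829s^8+84427122s^9+16389951s^{10}+2449224s^{11}+272257s^{12}+21430s^{13}+1099s^{14}+28s^{15})$, $g_4^-=(3+s)(334968777+2143174869s+5776302213s^2+8923510233s^3+8999893881s^4+6350646645s^5+3281293773s^6+1278719217s^7+383574771s^8+89689431s^9+16510551s^{10}+2388627s^{11}+267339s^{12}+22239s^{13}+1239s^{14}+35s^{15})$. *)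

(* Defs.v *)
From Stdlib Require Import BinNat.
From mathcomp Require Import all_boot all_order all_algebra generic_quotient.
From mathcomp Require Import ring.

Set Implicit Arguments.
Unset Strict Implicit.
Unset Printing Implicit Defensive.

Import GRing.Theory.
Local Open Scope ring_scope.
Local Open Scope quotient_scope.

Section Okamoto.
Variable C : fieldType.

Definition ratfun := {fraction {poly C}}.

Definition cst (c : C) : ratfun := tofrac c%:P.
Definition w : ratfun := tofrac 'X.
Definition t : ratfun := ((w + 1) * (w - 3) ^+ 3) / ((w - 1) * (w + 3) ^+ 3).

(* The quotient rule on a representative fraction; by ddw_frac the value does
   not depend on the representative. *)
Definition ddw (x : ratfun) : ratfun :=
  let n := \n_(repr x) in let d := \d_(repr x) in
  tofrac (n^`() * d - n * d^`()) / tofrac (d ^+ 2).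

Lemma tofrac_ratio (r : {ratio {poly C}}) :
  \pi_(ratfun) r = tofrac \n_r / tofrac \d_r.
Proof.
apply: (mulIf (x := tofrac \d_r)); first by rewrite tofrac_eq0 denom_ratioP.
rewrite mulfVK ?tofrac_eq0 ?denom_ratioP //; unlock FracField.tofrac.
rewrite -[LHS](FracField.pi_mul r (Ratio \d_r 1)); apply/eqmodP.
rewrite /= FracField.equivfE /FracField.mulf /=.
by rewrite !numden_Ratio ?mulr1 ?oner_eq0 ?denom_ratioP // mulrC.
Qed.

Lemma ddw_frac (n d : {poly C}) : d != 0 ->
  ddw (tofrac n / tofrac d) = tofrac (n^`() * d - n * d^`()) / tofrac (d ^+ 2).
Proof.
move=> d0; rewrite /ddw; set x := tofrac n / tofrac d.
have b0 := denom_ratioP (repr x).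
have : x = tofrac \n_(repr x) / tofrac \d_(repr x).
  by rewrite -tofrac_ratio reprK.
move: b0; move: (\n_(repr x)) (\d_(repr x)) => a b b0 /eqP.
rewrite eqr_div ?tofrac_eq0 // -!tofracM tofrac_eq => /eqP E.
have E' := congr1 (@deriv _) E; rewrite !derivM in E'.
apply/eqP; rewrite eqr_div ?tofrac_eq0 ?expf_neq0 // -!tofracM tofrac_eq.
rewrite -subr_eq0; apply/eqP.
(* with E : n b = a d the difference is a combination of E and its derivative *)
have -> : (a^`() * b - a * b^`()) * d ^+ 2 - (n^`() * d - n * d^`()) * b ^+ 2
  = b * d * ((a^`() * d + a * d^`()) - (n^`() * b + n * b^`()))
    + (d * b^`() + b * d^`()) * (n * b - a * d).
  by ring.
by rewrite E E' !subrr !mulr0 addr0.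
Qed.

Definition ddt (x : ratfun) : ratfun := ddw x / ddw t.

Definition vec4 := 'rV[C]_4.
Definition dot (u v : vec4) : C := \sum_(i < 4) u 0 i * v 0 i.
Definition mu : vec4 := const_mx 2^-1.
(* Indexed from 1: eps 1, ..., eps 4 is the standard basis. *)
Definition eps (j : nat) : vec4 := \row_(i < 4) (i.+1 == j)%:R.

Definition pair := (ratfun * vec4)%type.

(* A transformation returns None where it is undefined. *)
Definition transf := pair -> option pair.

Definition reflection (j : nat) (c : C) : transf := fun L =>
  let: (l, th) := L in Some (l, th - (2 * (dot (eps j) th - c)) *: eps j).

Definition R1 := reflection 1 0.
Definition R2 := reflection 2 0.
Definition R3 := reflection 3 0.
Definition R4 := reflection 4 1.

Definition R5 : transf := fun L =>
  let: (l, th) := L in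
  let l' := ddt l in
  let den := ((t - 1) * l' - cst (dot (eps 1) th)) / l
             + (l' - 1 - cst (dot (eps 2) th)) / (l - t)
             - (t * l' + cst (dot (eps 3) th)) / (l - 1) in
  if [&& l != 0, l - t != 0, l - 1 != 0 & den != 0] then
    Some (l + cst (2 * dot mu th) / den, th - (2 * dot mu th) *: mu)
  else None.

(* [:: f; g; h] denotes the product f g h: h acts first. *)
Definition prod_transf (fs : seq transf) : transf :=
  foldr (fun f g => pcomp f g) Some fs.

Definition B := prod_transf [:: R1; R2; R3; R5; R4; R5; R3; R2; R1].
Definition Q := prod_transf [:: B; R5].
Definition Qinv := prod_transf [:: R5; B].

Definition iter_transf (m : nat) (f : transf) : transf := fun L =>
  iter m (obind f) (Some L).

Definition s : ratfun := w ^+ 2.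

(* [:: c0; c1; ...; cn] denotes c0 + c1 s + ... + cn s^n; the coefficients are
   binary numerals because they are too large for unary ones. *)
Definition spoly (cs : seq N) : ratfun :=
  (Poly [seq (nat_of_bin c)%:R | c <- cs]).[s].

(* The tables are only meaningful for m <= 4. *)
Definition f_plus (m : nat) : ratfun :=
  match m with
  | 0 => 1
  | 1 => 1
  | 2 => 12 * (3 + s) ^+ 2
  | 3 => 8 * spoly [:: 3381; 7536; 6291; 2576; 611; 80; 5]%num
  | 4 => 4 * spoly [:: 14619528; 69918552; 140631309; 159541866; 116463663;
                       58384152; 20911122; 5489100; 1072278; 154176; 15729;
                       1050; 35]%num
  | _ => 0
  end.

Definition g_plus (m : nat) : ratfun :=
  match m with
  | 0 => 0
  | 1 => 0
  | 2 => (s - 1) ^+ 2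
  | 3 => (s - 1) ^+ 2 * (3 + s) * spoly [:: 147; 111; 57; 5]%num
  | 4 => 3 * (s - 1) ^+ 2 * (3 + s)
         * spoly [:: 141372; 402732; 558819; 432297; 209331; 71361; 16497;
                     2403; 189; 7]%num
  | _ => 0
  end.

Definition f_minus (m : nat) : ratfun :=
  match m with
  | 0 => 0
  | 1 => 4
  | 2 => 16 * (7 + s) * (4 + 3 * s + s ^+ 2)
  | 3 => 12 * (3 + s) ^+ 2
         * spoly [:: 3528; 7272; 6453; 2460; 678; 84; 5]%num
  | 4 => 8 * spoly [:: 326559519; 1822652766; 4648210677; 6998194368;
                       7025103459; 5035679226; 2678780673; 1084740444;
                       341288829; 84427122; 16389951; 2449224; 272257; 21430;
                       1099; 28]%num
  | _ => 0
  end.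

Definition g_minus (m : nat) : ratfun :=
  match m with
  | 0 => 1
  | 1 => 3 + s
  | 2 => (3 + s) * spoly [:: 77; 89; 23; 3]%num
  | 3 => spoly [:: 164052; 590328; 831465; 631260; 294435; 88938; 18207; 2520;
                   225; 10]%num
  | 4 => (3 + s)
         * spoly [:: 334968777; 2143174869; 5776302213; 8923510233;
                     8999893881; 6350646645; 3281293773; 1278719217;
                     383574771; 89689431; 16510551; 2388627; 267339; 22239;
                     1239; 35]%num
  | _ => 0
  end.

Definition lambda (f g : ratfun) : ratfun :=
  (w - 3) ^+ 2 / ((w - 1) * (w + 3))
  * (((w ^+ 2 - 1) * f + 8 * g) / ((w ^+ 2 + 3) * f - 24 * g)).

Definition Lambda_plus (m : nat) : pair :=
  (lambda (f_plus m) (g_plus m), (2 * m + 1)%:R *: mu).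
Definition Lambda_minus (m : nat) : pair :=
  (lambda (f_minus m) (g_minus m), - ((2 * m + 1)%:R *: mu)).

End Okamoto.

(* Main.v *)
(* The two chains interleave: R5 Lambda_m^+ = Lambda_m^- and
   B Lambda_m^- = Lambda_(m+1)^+, and since Q = B R5 and Qinv = R5 B these two
   facts give both claims by induction on m.

   Every function met on the way has the form k A(s) / D(s) with A, D integer
   polynomials in s = w^2 and k = (w - 3)^2 / ((w - 1) (w + 3)), and R5
   is only applied at parameter vectors of the form (x, x, x, y).  On such pairs
   it is rational in s: with a = 2 x, c = 3 x + y,
     G = (s-9)^2 A^2 - 2 (s^2+18s-27) A D + (s-1)(s-9) D^2,
     J = 4s(s-1)(s-9) (A' D - A D') + 16 s A D
         + 2(a+1) A ((s-9)^2 A - (s^2+18s-27) D) + a G,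
   it replaces A / D by A (J - 2 c G) / (D J).  Here G is the product of the
   numerators of lambda - t and lambda - 1, which are exchanged by w -> -w.  What
   remains are finitely many identities in Z[s]. *)
Require Import Defs.
From Stdlib Require Import BinInt BinNat.
From mathcomp Require Import all_boot all_order all_algebra.
From mathcomp Require Import reals.
From mathcomp Require Import complex.
From mathcomp Require Import ring zify ssrZ.

Set Implicit Arguments.
Unset Strict Implicit.
Unset Printing Implicit Defensive.

Import Order.TTheory GRing.Theory Num.Theory.
Local Open Scope ring_scope.

(** * Computable polynomials over Z and the boolean checks *)

(* Integer polynomials as coefficient lists, constant term first, possibly with
   trailing zeros. *)
Fixpoint zadd (p q : seq Z) : seq Z :=
  match p, q with
  | [::], _ => q
  | _, [::] => p
  | a :: p', b :: q' => Z.add a b :: zadd p' q'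
  end.

Definition zscale (c : Z) (p : seq Z) : seq Z := [seq Z.mul c a | a <- p].

Fixpoint zmul (p q : seq Z) : seq Z :=
  if p is a :: p' then zadd (zscale a q) (Z0 :: zmul p' q) else [::].

(** Follows (a + X p')' = p' + X (p')', so that no exponent has to be tracked. *)
Fixpoint zderiv (p : seq Z) : seq Z :=
  if p is a :: p' then zadd p' (Z0 :: zderiv p') else [::].

Definition zsub (p q : seq Z) : seq Z := zadd p (zscale (Zneg 1) q).

Definition zeq0 (p : seq Z) : bool := all (Z.eqb 0) p.

Definition zcst (n : nat) : seq Z := [:: Z.of_nat n].
Definition zX : seq Z := [:: Z.of_nat 0; Z.of_nat 1].
Definition zwronskian (p q : seq Z) : seq Z :=
  zsub (zmul (zderiv p) q) (zmul p (zderiv q)).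

Declare Scope zlist_scope.
Delimit Scope zlist_scope with zl.
Local Notation "p + q" := (zadd p q) : zlist_scope.
Local Notation "p - q" := (zsub p q) : zlist_scope.
Local Notation "p * q" := (zmul p q) : zlist_scope.

Definition zG (A D : seq Z) : seq Z :=
  ((zX - zcst 9) * (zX - zcst 9) * (A * A)
   - zcst 2 * (zX * zX + zcst 18 * zX - zcst 27) * (A * D)
   + (zX - zcst 1) * (zX - zcst 9) * (D * D))%zl.

Definition zJ (a : nat) (A D : seq Z) : seq Z :=
  (zcst 4 * zX * (zX - zcst 1) * (zX - zcst 9) * zwronskian A D
   + zcst 16 * zX * (A * D)
   + zcst 2 * zcst a.+1 * A * ((zX - zcst 9) * (zX - zcst 9) * A
                               - (zX * zX + zcst 18 * zX - zcst 27) * D)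
   + zcst a * zG A D)%zl.

(* Here a = 2 x and c = 3 x + y for the parameter vector (x, x, x, y). *)
Definition step_num (a c : nat) (A D : seq Z) : seq Z :=
  (A * (zJ a A D - zcst 2 * zcst c * zG A D))%zl.
Definition step_den (a : nat) (A D : seq Z) : seq Z := (D * zJ a A D)%zl.

Definition step_defined (a : nat) (A D : seq Z) : bool :=
  [&& ~~ zeq0 A, ~~ zeq0 D, ~~ zeq0 (zG A D) & ~~ zeq0 (zJ a A D)].

Definition lambda_num (f g : seq Z) : seq Z :=
  ((zX - zcst 1) * f + zcst 8 * g)%zl.
Definition lambda_den (f g : seq Z) : seq Z :=
  ((zX + zcst 3) * f - zcst 24 * g)%zl.

(** Cross-multiplied form of A / D = A' / D'; that D is nonzero comes from [step_den_neq0]. *)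
Definition same_ratio (A D A' D' : seq Z) : bool :=
  ~~ zeq0 D' && zeq0 (zsub (zmul A D') (zmul A' D)).

(** At the parameters (a, a, a, a) / 2 the quantity c = 3 x + y equals 2 a. *)
Definition check_R5 (a : nat) (A D A' D' : seq Z) : bool :=
  step_defined a A D &&
  same_ratio (step_num a a.*2 A D) (step_den a A D) A' D'.

(* B is conjugate to R4 by R5 R3 R2 R1: the two R5 steps inside it start from
   parameters (a, a, a, -a) / 2 and (0, 0, 0, a + 2). *)
Definition check_B (a : nat) (A D A' D' : seq Z) : bool :=
  let A1 := step_num a a A D in let D1 := step_den a A D in
  [&& step_defined a A D, step_defined 0 A1 D1
    & same_ratio (step_num 0 a.+2 A1 D1) (step_den 0 A1 D1) A' D'].

Fixpoint zexp (p : seq Z) (n : nat) : seq Z :=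
  if n is n'.+1 then zmul p (zexp p n') else zcst 1.

(** * Rational identities in w behind one [R5] step *)

(* n / m is lambda and T / S is t; the products are left as the Leibniz rule
   produces them. *)
Lemma field_derivative (K : fieldType) (w a a' d d' : K) :
  2 != 0 :> K -> w != 0 -> w - 1 != 0 -> w - 3 != 0 -> w + 3 != 0 -> d != 0 ->
  let n := (w - 3) * (w - 3) * a in
  let n' := ((w - 3) + (w - 3)) * a + (w - 3) * (w - 3) * (a' * (w + w)) in
  let m := (w - 1) * (w + 3) * d in
  let m' := ((w + 3) + (w - 1)) * d + (w - 1) * (w + 3) * (d' * (w + w)) in
  let T := (w + 1) * (w - 3) * (w - 3) * (w - 3) in
  let T' := (((w - 3) + (w + 1)) * (w - 3) + (w + 1) * (w - 3)) * (w - 3)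
            + (w + 1) * (w - 3) * (w - 3) in
  let S := (w - 1) * (w + 3) * (w + 3) * (w + 3) in
  let S' := (((w + 3) + (w - 1)) * (w + 3) + (w - 1) * (w + 3)) * (w + 3)
            + (w - 1) * (w + 3) * (w + 3) in
  ((n' * m - n * m') / (m * m)) / ((T' * S - T * S') / (S * S))
  = (w + 3) ^+ 2 * (4 * a * d + (w - 3) * (w - 1) * (w + 3) * (a' * d - a * d'))
    / (8 * w * (w - 3) * d ^+ 2).
Proof.
move=> nz2 w0 wm1 wm3 wp3 d0 n n' m m' T T' S S'.
have nz8 : 8 != 0 :> K.
  by have -> : 8 = 2 ^+ 3 :> K by [ring]; rewrite expf_neq0.
have nz16 : 16 != 0 :> K.
  by have -> : 16 = 2 ^+ 4 :> K by [ring]; rewrite expf_neq0.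
(* The numerator of dt/dw splits into factors known to be nonzero, as [field] requires. *)
have -> : T' * S - T * S'
  = 16 * w ^+ 2 * (w - 3) ^+ 2 * (w + 3) ^+ 2.
  by rewrite /T /T' /S /S'; ring.
rewrite /n /n' /m /m' /S; field.
by rewrite nz8 nz16 w0 wm1 wm3 wp3 d0.
Qed.

(** [V] stands for the Wronskian A' D - A D' and [y] for the common value of the first three
    parameters, so a = 2 y. Over the common denominator P M everything becomes even in w except a
    factor 1 / k. *)
Lemma field_denominator (K : fieldType) (w A D V y : K) :
  2 != 0 :> K -> w != 0 -> w - 1 != 0 -> w - 3 != 0 -> w + 3 != 0 ->
  A != 0 -> D != 0 ->
  let s := w ^+ 2 in
  let G := (s - 9) ^+ 2 * A ^+ 2 - 2 * (s ^+ 2 + 18 * s - 27) * A * D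
           + (s - 1) * (s - 9) * D ^+ 2 in
  let J := 4 * s * (s - 1) * (s - 9) * V + 16 * s * A * D
           + 2 * (2 * y + 1) * A
             * ((s - 9) ^+ 2 * A - (s ^+ 2 + 18 * s - 27) * D)
           + 2 * y * G in
  let t := (w + 1) * (w - 3) ^+ 3 / ((w - 1) * (w + 3) ^+ 3) in
  let l := (w - 3) ^+ 2 / ((w - 1) * (w + 3)) * (A / D) in
  let l' := (w + 3) ^+ 2 * (4 * A * D + (w - 3) * (w - 1) * (w + 3) * V)
            / (8 * w * (w - 3) * D ^+ 2) in
  G != 0 ->
  [/\ l != 0, l - t != 0, l - 1 != 0
    & ((t - 1) * l' - y) / l + (l' - 1 - y) / (l - t) - (t * l' + y) / (l - 1)
      = - (D * J * (w - 1) * (w + 3) / (2 * A * G * (w - 3) ^+ 2))].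
Proof.
move=> nz2 w0 wm1 wm3 wp3 A0 D0 s G J t l l'.
pose P := (w + 3) ^+ 2 * A - (w + 1) * (w - 3) * D.
pose M := (w - 3) ^+ 2 * A - (w - 1) * (w + 3) * D.
(* P and M are the numerators of l - t and l - 1. *)
have GE : G = P * M by rewrite /G /P /M /s; ring.
rewrite GE mulf_eq0 negb_or => /andP[P0 M0].
have ltE : l - t = (w - 3) ^+ 2 * P / ((w - 1) * (w + 3) ^+ 3 * D).
  by rewrite /l /t /P; field; rewrite wm1 wp3 D0.
have l1E : l - 1 = M / ((w - 1) * (w + 3) * D).
  by rewrite /l /M; field; rewrite wm1 wp3 D0.
split.
- by rewrite !(mulf_neq0, invr_neq0, expf_neq0).
- by rewrite ltE !(mulf_neq0, invr_neq0, expf_neq0).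
- by rewrite l1E !(mulf_neq0, invr_neq0, expf_neq0).
have nz8 : 8 != 0 :> K.
  by have -> : 8 = 2 ^+ 3 :> K by [ring]; rewrite expf_neq0.
rewrite l1E ltE /J GE /l /l' /t /s; move: P0 M0; rewrite /P /M => P0 M0.
by field; rewrite nz2 nz8 w0 wm1 wm3 wp3 A0 D0 P0 M0.
Qed.

(** The reciprocal of the [R5] denominator is -2 k A G / (D J), with the same factor k as lambda, so
    the shape k A / D survives. *)
Lemma field_step (K : fieldType) (w A D G J c : K) :
  2 != 0 :> K -> w - 1 != 0 -> w - 3 != 0 -> w + 3 != 0 ->
  A != 0 -> D != 0 -> G != 0 -> J != 0 ->
  (w - 3) ^+ 2 / ((w - 1) * (w + 3)) * (A / D)
  + c / - (D * J * (w - 1) * (w + 3) / (2 * A * G * (w - 3) ^+ 2))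
  = (w - 3) ^+ 2 / ((w - 1) * (w + 3)) * (A * (J - 2 * c * G) / (D * J)).
Proof.
move=> nz2 wm1 wm3 wp3 A0 D0 G0 J0.
by field; rewrite oppr_eq0 !mulf_eq0 !negb_or nz2 wm1 wm3 wp3 A0 D0 G0 J0.
Qed.

(** * Coefficient lists evaluated at s = w^2 *)

Section Solutions.
Variable C : numFieldType.
Local Notation w := (w C).
Local Notation s := (s C).
Local Notation F := (ratfun C).
Implicit Types (p q A D : seq Z).

Definition ofZ (c : Z) : C := (int_of_Z c)%:~R.

Lemma ofZD (a b : Z) : ofZ (Z.add a b) = ofZ a + ofZ b.
Proof. by rewrite /ofZ -intrD -(rmorphD int_of_Z). Qed.

Lemma ofZM (a b : Z) : ofZ (Z.mul a b) = ofZ a * ofZ b.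
Proof. by rewrite /ofZ -intrM -(rmorphM int_of_Z). Qed.

(** Characteristic zero enters here: it lets vanishing in [C] be decided on integers. *)
Lemma ofZ_eq0 (a : Z) : (ofZ a == 0) = (Z.eqb 0 a).
Proof.
by rewrite /ofZ intr_eq0 -(rmorph0 int_of_Z) (can_eq int_of_ZK) eq_sym.
Qed.

Lemma ofZ_of_N (n : N) : ofZ (Z.of_N n) = (nat_of_bin n)%:R.
Proof. by rewrite /ofZ pmulrn; congr (_ *~ _); lia. Qed.

Lemma ofZ_of_nat (n : nat) : ofZ (Z.of_nat n) = n%:R.
Proof. by rewrite /ofZ pmulrn; congr (_ *~ _); lia. Qed.

Fixpoint zpoly p : {poly C} :=
  if p is c :: p' then zpoly p' * 'X + (ofZ c)%:P else 0.

Lemma zpolyD p q : zpoly (zadd p q) = zpoly p + zpoly q.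
Proof.
elim: p q => [|a p IH] [|b q] /=; rewrite ?add0r ?addr0 //.
by rewrite IH ofZD polyCD; ring.
Qed.

Lemma zpolyZ (c : Z) p : zpoly (zscale c p) = (ofZ c)%:P * zpoly p.
Proof.
by elim: p => [|a p IH] /=; rewrite ?mulr0 // IH ofZM polyCM; ring.
Qed.

Lemma zpolyM p q : zpoly (zmul p q) = zpoly p * zpoly q.
Proof.
elim: p => [|a p IH] /=; rewrite ?mul0r // zpolyD zpolyZ /= IH.
by rewrite (ofZ_of_nat 0); ring.
Qed.

Lemma zpoly_deriv p : zpoly (zderiv p) = (zpoly p)^`().
Proof.
elim: p => [|a p IH] /=; rewrite ?deriv0 // zpolyD /= IH !derivE.
by rewrite (ofZ_of_nat 0); ring.
Qed.

Lemma zpoly_eq0 p : (zpoly p == 0) = zeq0 p.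
Proof.
elim: p => [|c p IH] /=; first by rewrite eqxx.
rewrite -cons_poly_def -size_poly_eq0 size_cons_poly nil_poly IH ofZ_eq0.
by rewrite andbC; case: ifP.
Qed.

Definition ev p : ratfun C := tofrac (zpoly p \Po 'X^2).

Lemma evD p q : ev (zadd p q) = ev p + ev q.
Proof. by rewrite /ev zpolyD !rmorphD. Qed.

Lemma evM p q : ev (zmul p q) = ev p * ev q.
Proof. by rewrite /ev zpolyM !rmorphM. Qed.

Lemma ev_nil : ev [::] = 0.
Proof. by rewrite /ev !rmorph0. Qed.

Lemma ev_cons (c : Z) p : ev (c :: p) = cst (ofZ c) + s * ev p.
Proof.
rewrite /ev /= rmorphD rmorphM /= comp_polyX comp_polyC rmorphD rmorphM /=.
by rewrite rmorphXn addrC mulrC.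
Qed.

Lemma evZ (c : Z) p : ev (zscale c p) = cst (ofZ c) * ev p.
Proof. by rewrite /ev zpolyZ rmorphM /= comp_polyC rmorphM. Qed.

(** Substituting the nonconstant polynomial X^2 is injective. *)
Lemma ev_eq0 p : (ev p == 0) = zeq0 p.
Proof.
by rewrite -zpoly_eq0 tofrac_eq0 comp_poly_eq0 // size_polyXn.
Qed.

Lemma evB p q : ev (zsub p q) = ev p - ev q.
Proof.
rewrite evD evZ; congr (_ + _).
rewrite (_ : ofZ _ = -1); last by rewrite /ofZ.
by rewrite /cst rmorphN1 rmorphN1 mulN1r.
Qed.

Lemma cst_nat n : cst n%:R = n%:R :> F.
Proof. by rewrite /cst !rmorph_nat. Qed.

Lemma ev_cst n : ev (zcst n) = n%:R.
Proof. by rewrite ev_cons ev_nil mulr0 addr0 ofZ_of_nat cst_nat. Qed.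

Lemma ev_zX : ev zX = s.
Proof.
by rewrite !ev_cons ev_nil !ofZ_of_nat !cst_nat mulr0 addr0 mulr1 add0r.
Qed.

Lemma cst_div (a b : C) : cst (a / b) = cst a / cst b.
Proof.
by have := fmorph_div (@tofrac {poly C} \o @polyC C) a b.
Qed.

Lemma natr_ratfun_eq0 n : (n%:R == 0 :> F) = (n == 0)%N.
Proof. by rewrite -cst_nat /cst tofrac_eq0 polyC_eq0 pnatr_eq0. Qed.

Lemma wD_neq0 (c : C) : w + cst c != 0.
Proof.
by rewrite -[c]opprK /cst polyCN -tofracD tofrac_eq0 polyXsubC_eq0.
Qed.

Lemma cstN (c : C) : cst (- c) = - cst c.
Proof. by rewrite /cst !rmorphN. Qed.

(** * Functions of the form k A(s) / D(s) and their t-derivative *)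

Definition sol (A D : seq Z) : F :=
  (w - 3) ^+ 2 / ((w - 1) * (w + 3)) * (ev A / ev D).

Lemma tofrac_nat n : tofrac (n%:R : {poly C}) = n%:R.
Proof. exact: rmorph_nat. Qed.

Let tofracE := (tofracM, tofracB, tofracD, tofrac1, tofrac_nat).

Lemma w_neq0 : [/\ w != 0, w - 1 != 0, w - 3 != 0 & w + 3 != 0].
Proof.
split.
- by have := wD_neq0 0%:R; rewrite cst_nat addr0; apply.
- by have := wD_neq0 (- 1%:R); rewrite cstN cst_nat; apply.
- by have := wD_neq0 (- 3%:R); rewrite cstN cst_nat; apply.
- by have := wD_neq0 3%:R; rewrite cst_nat; apply.
Qed.

Lemma ddt_sol (A D : seq Z) : ~~ zeq0 D ->
  ddt (sol A D) =
  (w + 3) ^+ 2 * (4 * ev A * ev D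
                  + (w - 3) * (w - 1) * (w + 3) * ev (zwronskian A D))
  / (8 * w * (w - 3) * ev D ^+ 2).
Proof.
move=> D0; have [w0 wm1 wm3 wp3] := w_neq0.
have d0 : ('X - 1) * ('X + 3) * (zpoly D \Po 'X^2) != 0.
  rewrite -tofrac_eq0 !tofracE.
  apply: mulf_neq0; first exact: mulf_neq0 wm1 wp3.
  by rewrite -[tofrac _]/(ev D) ev_eq0.
have d1 : ('X - 1) * ('X + 3) * ('X + 3) * ('X + 3) != 0 :> {poly C}.
  rewrite -tofrac_eq0 !tofracE.
  exact: mulf_neq0 (mulf_neq0 (mulf_neq0 wm1 wp3) wp3) wp3.
have solE : sol A D = tofrac (('X - 3) * ('X - 3) * (zpoly A \Po 'X^2))
  / tofrac (('X - 1) * ('X + 3) * (zpoly D \Po 'X^2)).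
  rewrite !tofracE.
  rewrite /sol -[tofrac 'X]/w -[tofrac (zpoly A \Po _)]/(ev A).
  by rewrite -[tofrac (zpoly D \Po _)]/(ev D) !invfM; ring.
have tE : t C = tofrac (('X + 1) * ('X - 3) * ('X - 3) * ('X - 3))
  / tofrac (('X - 1) * ('X + 3) * ('X + 3) * ('X + 3)).
  rewrite !tofracE.
  by rewrite -[tofrac 'X]/w /t !invfM; ring.
rewrite /ddt solE tE !ddw_frac //.
have dB n : ('X - n%:R : {poly C})^`() = 1.
  by rewrite derivB derivX -polyC_natr derivC subr0.
have dD n : ('X + n%:R : {poly C})^`() = 1.
  by rewrite derivD derivX -polyC_natr derivC addr0.
have fB n : tofrac ('X - n%:R : {poly C}) = w - n%:R.
  by rewrite tofracB tofrac_nat.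
have fD n : tofrac ('X + n%:R : {poly C}) = w + n%:R.
  by rewrite tofracD tofrac_nat.
have comp2 (p : {poly C}) : (p \Po 'X^2)^`() = (p^`() \Po 'X^2) * ('X + 'X).
  by rewrite deriv_comp derivXn mulr2n.
(* The literal 1 is only convertible to [1%:R], hence the separate instances at [1%N]. *)
rewrite !(derivM, dB, dB 1%N, dD, dD 1%N, comp2) -!zpoly_deriv !(mul1r, mulr1).
rewrite !(fB, fB 1%N, fD, fD 1%N, tofracM, tofracB, tofracD, tofrac1).
rewrite evB !evM.
have nz2 : 2 != 0 :> F by rewrite natr_ratfun_eq0.
have evD0 : ev D != 0 by rewrite ev_eq0.
exact: (field_derivative (ev A) (ev (zderiv A)) (ev (zderiv D))
  nz2 w0 wm1 wm3 wp3 evD0).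
Qed.

(** * The transformations at parameters (x, x, x, y) *)

Lemma dot_eps (i : 'I_4) (th : vec4 C) : dot (eps C i.+1) th = th 0 i.
Proof.
rewrite /dot (bigD1 i) //= mxE eqxx mul1r big1 ?addr0 // => k ki.
by rewrite mxE eqSS val_eqE (negPf ki) mul0r.
Qed.

Definition theta (x y : C) : vec4 C :=
  \row_(i < 4) if i == 3 :> nat then y else x.

Lemma dot_mu x y : 2 * dot (mu C) (theta x y) = 3 * x + y.
Proof.
rewrite /dot !big_ord_recl big_ord0 !mxE /=.
by field.
Qed.

(** A single one of these reflections leaves the family [theta x y] in general, so the three are
    treated together; [B] contains them in both orders. *)
Lemma reflections123 l x y :
  obind (@R1 C) (obind (@R2 C) (@R3 C (l, theta x y)))
  = Some (l, theta (- x) y) /\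
  obind (@R3 C) (obind (@R2 C) (@R1 C (l, theta x y)))
  = Some (l, theta (- x) y).
Proof.
have E1 th : dot (eps C 1) th = th 0 (Ordinal (isT : 0 < 4)%N).
  by rewrite -dot_eps.
have E2 th : dot (eps C 2) th = th 0 (Ordinal (isT : 1 < 4)%N).
  by rewrite -dot_eps.
have E3 th : dot (eps C 3) th = th 0 (Ordinal (isT : 2 < 4)%N).
  by rewrite -dot_eps.
split; rewrite /R1 /R2 /R3 /reflection /=; congr (Some (_, _));
  rewrite E1 E2 E3.
  by apply/rowP => -[[|[|[|[|]]]] // i4]; rewrite !mxE /=; ring.
by apply/rowP => -[[|[|[|[|]]]] // i4]; rewrite !mxE /=; ring.
Qed.

Lemma reflection4 l x y : R4 (l, theta x y) = Some (l, theta x (2 - y)).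
Proof.
rewrite /R4 /reflection; congr (Some (_, _)).
rewrite (dot_eps (Ordinal (isT : 3 < 4)%N)).
by apply/rowP => -[[|[|[|[|]]]] // i4]; rewrite !mxE /=; ring.
Qed.

Lemma R5_defined (l den : F) (x y : C) :
  l != 0 -> l - t C != 0 -> l - 1 != 0 -> den != 0 ->
  ((t C - 1) * ddt l - cst x) / l + (ddt l - 1 - cst x) / (l - t C)
  - (t C * ddt l + cst x) / (l - 1) = den ->
  R5 (l, theta x y) = Some (l + cst (3 * x + y) / den,
    theta (x - (3 * x + y) / 2) (y - (3 * x + y) / 2)).
Proof.
move=> l0 lt0 l10 den0 denE; rewrite /R5 dot_mu.
have thE (i : 'I_4) : (i < 3)%N -> dot (eps C i.+1) (theta x y) = x.
  by rewrite dot_eps mxE; case: eqP => // ->.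
rewrite (thE (Ordinal (isT : 0 < 4)%N)) // (thE (Ordinal (isT : 1 < 4)%N)) //.
rewrite (thE (Ordinal (isT : 2 < 4)%N)) //; cbv zeta.
subst den; rewrite ifT; last exact/and4P.
congr (Some (_, _)).
by apply/rowP => -[[|[|[|[|]]]] // i4]; rewrite !mxE.
Qed.

(** The parameters are expressed through a = 2 x and c = 3 x + y because these are natural numbers
    in every step, which keeps all coefficients integral. *)
Lemma R5_sol (a c : nat) (A D : seq Z) : step_defined a A D ->
  R5 (sol A D, theta (a%:R / 2) (c%:R - 3 * (a%:R / 2)))
  = Some (sol (step_num a c A D) (step_den a A D),
          theta ((a%:R - c%:R) / 2) (c%:R / 2 - 3 * (a%:R / 2))).
Proof.
case/and4P; rewrite -!ev_eq0 => A0 D0 G0 J0.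
have [w0 wm1 wm3 wp3] := w_neq0.
have nz2 : 2 != 0 :> F by rewrite natr_ratfun_eq0.
have ev_zG : ev (zG A D) = (s - 9) ^+ 2 * ev A ^+ 2
   - 2 * (s ^+ 2 + 18 * s - 27) * ev A * ev D + (s - 1) * (s - 9) * ev D ^+ 2.
  by rewrite !(evD, evB, evM, ev_cst, ev_zX); ring.
have aE : 2 * (a%:R / 2) = a%:R :> F by rewrite mulrC divfK.
have ev_zJ : ev (zJ a A D) = 4 * s * (s - 1) * (s - 9) * ev (zwronskian A D)
   + 16 * s * ev A * ev D
   + 2 * (2 * (a%:R / 2) + 1) * ev A
     * ((s - 9) ^+ 2 * ev A - (s ^+ 2 + 18 * s - 27) * ev D)
   + 2 * (a%:R / 2) * ev (zG A D).
  by rewrite aE !(evD, evB, evM, ev_cst, ev_zX); ring.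
have cstE : cst (a%:R / 2) = a%:R / 2 :> F by rewrite cst_div !cst_nat.
set den := - (ev D * ev (zJ a A D) * (w - 1) * (w + 3)
              / (2 * ev A * ev (zG A D) * (w - 3) ^+ 2)).
have [l0 lt0 l10 denE] : [/\ sol A D != 0, sol A D - t C != 0,
    sol A D - 1 != 0
  & ((t C - 1) * ddt (sol A D) - a%:R / 2) / sol A D
    + (ddt (sol A D) - 1 - a%:R / 2) / (sol A D - t C)
    - (t C * ddt (sol A D) + a%:R / 2) / (sol A D - 1) = den].
  rewrite ddt_sol; last by rewrite -ev_eq0.
  move: G0; rewrite /den ev_zJ ev_zG => G0.
  exact: (field_denominator (ev (zwronskian A D)) _ nz2
    w0 wm1 wm3 wp3 A0 D0 G0).
have den0 : den != 0.
  rewrite oppr_eq0; apply: mulf_neq0; last apply: invr_neq0.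
    exact: mulf_neq0 (mulf_neq0 (mulf_neq0 D0 J0) wm1) wp3.
  exact: mulf_neq0 (mulf_neq0 (mulf_neq0 nz2 A0) G0) (expf_neq0 2 wm3).
rewrite -cstE in denE.
rewrite (R5_defined _ l0 lt0 l10 den0 denE) [3 * _ + _]addrC subrK cst_nat.
congr (Some (_, _)).
  rewrite /den /sol /step_num /step_den !(evB, evM, ev_cst).
  exact: (field_step _ nz2 wm1 wm3 wp3 A0 D0 G0 J0).
by congr theta; field.
Qed.

(** * From boolean checks to [R5] and [B] *)

Lemma eq_evD (x y : F) p q :
  x = ev p -> y = ev q -> x + y = ev (zadd p q).
Proof. by rewrite evD => -> ->. Qed.

Lemma eq_evB (x y : F) p q :
  x = ev p -> y = ev q -> x - y = ev (zsub p q).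
Proof. by rewrite evB => -> ->. Qed.

Lemma eq_evM (x y : F) p q :
  x = ev p -> y = ev q -> x * y = ev (zmul p q).
Proof. by rewrite evM => -> ->. Qed.

Lemma eq_evX (x : F) p n : x = ev p -> x ^+ n = ev (zexp p n).
Proof.
move=> ->; elim: n => [|n IH] /=; first by rewrite ev_cst.
by rewrite evM -IH exprS.
Qed.

Lemma ev_spoly cs : ev (map Z.of_N cs) = spoly C cs.
Proof.
rewrite /spoly; elim: cs => [|c cs IH] /=; first by rewrite horner0 ev_nil.
by rewrite cons_poly_def hornerMXaddC -IH ev_cons ofZ_of_N cst_nat addrC mulrC.
Qed.

Lemma lambda_sol (f g : F) p q : f = ev p -> g = ev q ->
  lambda f g = sol (lambda_num p q) (lambda_den p q).
Proof. by rewrite /sol !(evB, evD, evM, ev_zX, ev_cst) => -> ->. Qed.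

Lemma sol_eq A D A' D' : ~~ zeq0 D -> same_ratio A D A' D' ->
  sol A D = sol A' D'.
Proof.
rewrite /same_ratio -!ev_eq0 evB !evM subr_eq0.
move=> D0 /andP[D0' /eqP E]; congr (_ * _).
by apply/eqP; rewrite (eqr_div _ _ D0 D0') E.
Qed.

Lemma step_den_neq0 (a : nat) A D :
  step_defined a A D -> ~~ zeq0 (step_den a A D).
Proof.
case/and4P=> _ D0 _ J0.
by rewrite -ev_eq0 evM mulf_eq0 !ev_eq0 negb_or D0.
Qed.

Lemma R5_check (a : nat) A D A' D' : check_R5 a A D A' D' ->
  R5 (sol A D, theta (a%:R / 2) (a%:R / 2))
  = Some (sol A' D', theta (- (a%:R / 2)) (- (a%:R / 2))).
Proof.
case/andP=> ok E.
have -> : theta (a%:R / 2) (a%:R / 2)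
  = theta (a%:R / 2) (a.*2%:R - 3 * (a%:R / 2)) :> vec4 C.
  by congr theta; rewrite -muln2 natrM; field.
rewrite R5_sol // (sol_eq (step_den_neq0 ok) E).
by congr (Some (_, theta _ _)); rewrite -muln2 natrM; field.
Qed.

Lemma B_check (a : nat) A D A' D' : check_B a A D A' D' ->
  B (sol A D, theta (- (a%:R / 2)) (- (a%:R / 2)))
  = Some (sol A' D', theta (a.+2%:R / 2) (a.+2%:R / 2)).
Proof.
case/and3P=> ok1 ok2 E.
have a2E : a.+2%:R = a%:R + 2 :> C by rewrite -addn2 natrD.
(* Used to evaluate the nine factors of [B] one at a time, without unfolding the others. *)
have obindS T T' (f : T -> option T') x : obind f (Some x) = f x by [].
transitivity (obind (@R1 C) (obind (@R2 C) (obind (@R3 C) (obind (@R5 C)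
  (obind (@R4 C) (obind (@R5 C) (obind (@R3 C) (obind (@R2 C)
  (@R1 C (sol A D, theta (- (a%:R / 2)) (- (a%:R / 2)))))))))))); first by [].
rewrite (reflections123 _ _ _).2 opprK (obindS _ _ (@R5 C)).
(* After the reflections x = a / 2 and y = - a / 2, hence c = 3 x + y = a. *)
have -> : - (a%:R / 2) = a%:R - 3 * (a%:R / 2) :> C by field.
rewrite R5_sol // (obindS _ _ (@R4 C)) reflection4 (obindS _ _ (@R5 C)).
(* [R5] has produced (0, 0, 0, -a), and [R4] sends -a to a + 2. *)
have -> : theta ((a%:R - a%:R) / 2) (2 - (a%:R / 2 - 3 * (a%:R / 2)))
  = theta (0%:R / 2) (a.+2%:R - 3 * (0%:R / 2)) :> vec4 C.
  by rewrite a2E; congr theta; field.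
(* The second [R5] gives (-x, -x, -x, x) with x = (a + 2) / 2; the reflections remove the signs. *)
rewrite R5_sol // (obindS _ _ (@R3 C)) (reflections123 _ _ _).1.
rewrite (sol_eq (step_den_neq0 ok2) E).
by rewrite a2E; congr (Some (_, theta _ _)); field.
Qed.

Section Lambda.
Variables (m : nat) (F0 G0 F1 G1 : seq Z).
Local Notation a := (2 * m + 1)%N.

Lemma theta_mu (b : nat) : b%:R *: mu C = theta (b%:R / 2) (b%:R / 2).
Proof. by apply/rowP => i; rewrite !mxE; case: ifP. Qed.

Lemma theta_muN (b : nat) :
  - (b%:R *: mu C) = theta (- (b%:R / 2)) (- (b%:R / 2)).
Proof. by apply/rowP => i; rewrite !mxE; case: ifP. Qed.

Lemma R5_Lambda : f_plus C m = ev F0 -> g_plus C m = ev G0 ->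
  f_minus C m = ev F1 -> g_minus C m = ev G1 ->
  check_R5 a (lambda_num F0 G0) (lambda_den F0 G0)
    (lambda_num F1 G1) (lambda_den F1 G1) ->
  R5 (Lambda_plus C m) = Some (Lambda_minus C m).
Proof.
move=> hF0 hG0 hF1 hG1 ok; rewrite /Lambda_plus /Lambda_minus.
rewrite (lambda_sol hF0 hG0) (lambda_sol hF1 hG1) theta_muN theta_mu.
by rewrite (R5_check ok).
Qed.

Lemma B_Lambda : f_minus C m = ev F0 -> g_minus C m = ev G0 ->
  f_plus C m.+1 = ev F1 -> g_plus C m.+1 = ev G1 ->
  check_B a (lambda_num F0 G0) (lambda_den F0 G0)
    (lambda_num F1 G1) (lambda_den F1 G1) ->
  B (Lambda_minus C m) = Some (Lambda_plus C m.+1).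
Proof.
move=> hF0 hG0 hF1 hG1 ok; rewrite /Lambda_plus /Lambda_minus.
rewrite (lambda_sol hF0 hG0) (lambda_sol hF1 hG1) theta_muN theta_mu.
(* The new parameter matches because (2 m + 1) + 2 = 2 (m + 1) + 1. *)
by rewrite (B_check ok) mulnS addSn.
Qed.

End Lambda.

(** * Verification of the explicit tables by computation *)

(* Closes [x = ev ?p] by instantiating [?p]; matching on the syntax of [x] keeps
   unification from unfolding the arithmetic of fractions. *)
Ltac reify_ev :=
  cbv beta iota delta [f_plus g_plus f_minus g_minus];
  repeat lazymatch goal with
  | |- 0 = _ => symmetry; exact: ev_nil
  | |- 1 = _ => symmetry; exact: (ev_cst 1)
  | |- _%:R = _ => symmetry; exact: ev_cst
  | |- Defs.s _ = _ => symmetry; exact: ev_zX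
  | |- spoly _ _ = _ => symmetry; exact: ev_spoly
  | |- _ - _ = _ => eapply eq_evB
  | |- _ + _ = _ => eapply eq_evD
  | |- _ * _ = _ => eapply eq_evM
  | |- _ ^+ _ = _ => eapply eq_evX
  end.

Lemma R5_plus m : (m <= 4)%N -> R5 (Lambda_plus C m) = Some (Lambda_minus C m).
Proof.
case: m => [|[|[|[|[|]]]]] // _.
(* The lists start as unknowns; the reification goals fix them before the check is computed. *)
all: eapply R5_Lambda; [reify_ev .. | vm_compute; reflexivity].
Qed.

Lemma B_minus m :
  (m <= 3)%N -> B (Lambda_minus C m) = Some (Lambda_plus C m.+1).
Proof.
case: m => [|[|[|[|]]]] // _.
all: eapply B_Lambda; [reify_ev .. | vm_compute; reflexivity].
Qed.

Lemma obind_comp (f g : transf C) L : obind f (obind g L) = obind (pcomp f g) L.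
Proof. by case: L. Qed.

End Solutions.

(** * Both chains by induction on m *)

Theorem theorem1p2 (R : realType) (m : nat) (hm : (m <= 4)%N) :
  iter_transf m (@Q R[i]) (Lambda_plus R[i] 0) = Some (Lambda_plus R[i] m) /\
  iter_transf m (@Qinv R[i]) (Lambda_minus R[i] 0) = Some (Lambda_minus R[i] m).
Proof.
elim: m hm => [|m IH] // hm; have [IH1 IH2] := IH (ltnW hm).
have Pm := R5_plus R[i] (ltnW hm).
have Pm1 := R5_plus R[i] hm.
(* The bound m + 1 <= 4 is convertible to the required m <= 3. *)
have Bm := B_minus R[i] hm.
split.
  (* [Q] passes through Lambda_m^- on its way to Lambda_(m+1)^+. *)
  transitivity (obind (@B R[i]) (obind (@R5 R[i])
    (iter_transf m (@Q R[i]) (Lambda_plus R[i] 0)))).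
    by rewrite obind_comp.
  by rewrite IH1 /obind [oapp _ _ (Some _)]Pm; exact: Bm.
(* [Qinv] passes through Lambda_(m+1)^+, so the [R5] fact is used at m + 1. *)
transitivity (obind (@R5 R[i]) (obind (@B R[i])
    (iter_transf m (@Qinv R[i]) (Lambda_minus R[i] 0)))).
  by rewrite obind_comp.
by rewrite IH2 /obind [oapp _ _ (Some _)]Bm; exact: Pm1.
Qed.
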